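(* Let $\mathfrak{q}>0$ be a real number. Define polynomials $W_k(x)$, $k\ge 0$, by $W_0(x)=1$, $W_1(x)=1+\mathfrak{q}x$, and $W_k(x)=W_{k-1}(x)+xW_{k-2}(x)$ for $k\ge 2$. Then for every integer $k\ge 2$ and every real $x\neq 0$, \[\overline{G}^{\mathfrak{q},1}_{k}(x)=x^{\lfloor k/2\rfloor}\,W_{k-1}\!\left(-\tfrac{1}{x}\right).\]
   Context: For positive real numbers $\alpha,\beta$, define numbers $g_{k,j}=g^{\alpha,\beta}_{k,j}$ for integers $k\ge 0$ and $j$ by: $g_{0,0}=\alpha$, $g_{1,0}=\beta$, $g_{k,j}=0$ whenever $j<0$ or $j>\lfloor k/2\rfloor$, and $g_{k,j}=g_{k-1,j}+g_{k-2,j-1}$ for $k\ge 2$ and $0\le j\le\lfloor k/2\rfloor$. The sign-alternating Gibonacci polynomials are $\overline{G}^{\alpha,\beta}_k(x)=\sum_{j=0}^{\lfloor k/2\rfloor}(-1)^j g_{k,j}\,x^{\lfloor k/2\rfloor-j}$. Equivalently, $\overline{G}^{\alpha,\beta}_0(x)=\alpha$, $\overline{G}^{\alpha,\beta}_1(x)=\beta$, and $\overline{G}^{\alpha,\beta}_k(x)=x^{(k-1)\bmod 2}\,\overline{G}^{\alpha,\beta}_{k-1}(x)-\overline{G}^{\alpha,\beta}_{k-2}(x)$ for $k\ge 2$. Here $\overline{G}^{\mathfrak{q},1}_k$ denotes the case $\alpha=\mathfrak{q}$, $\beta=1$. *)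

(* Defs.v *)
From mathcomp Require Import all_boot all_order all_algebra.
From mathcomp Require Import reals.

Set Implicit Arguments.
Unset Strict Implicit.
Unset Printing Implicit Defensive.

Import Order.TTheory GRing.Theory Num.Theory.
Local Open Scope ring_scope.

(* The lower index j ranges over all integers. In the last branch k = k2.+2,
   k1 = k - 1 and k2 = k - 2. *)
Fixpoint gib (R : realType) (alpha beta : R) (k : nat) (j : int) : R :=
  if (j < 0) || ((k./2)%:Z < j) then 0 else
  match k with
  | 0%N => alpha
  | k1.+1 =>
    match k1 with
    | 0%N => beta
    | k2.+1 => gib alpha beta k1 j + gib alpha beta k2 (j - 1)
    end
  end.

Definition Gbar (R : realType) (alpha beta : R) (k : nat) : {poly R} :=
  \sum_(0 <= j < (k./2).+1)
    ((-1) ^+ j * gib alpha beta k j%:Z) *: 'X^(k./2 - j).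

Fixpoint W (R : realType) (q : R) (k : nat) : {poly R} :=
  match k with
  | 0%N => 1
  | k1.+1 =>
    match k1 with
    | 0%N => 1 + q *: 'X
    | k2.+1 => W q k1 + 'X * W q k2
    end
  end.

(* Main.v *)
(** Dividing the alternating Gibonacci polynomial of index [k] by [x ^ (k/2)]
    gives the ordinary generating polynomial [\sum_j g_{k,j} y^j] evaluated at
    [y = -1/x].  These generating polynomials satisfy the recurrence of [W], and
    those of index 1 and 2 are [W 0] and [W 1]. *)
Require Import Defs.
From mathcomp Require Import all_boot all_order all_algebra.
From mathcomp Require Import reals.
From mathcomp Require Import zify ring.

Import Order.TTheory GRing.Theory Num.Theory.
Local Open Scope ring_scope.

Lemma gib_eq0 (R : realType) (alpha beta : R) (k : nat) (j : int) :
  (j < 0) || ((k./2)%:Z < j) -> gib alpha beta k j = 0.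
Proof. by case: k => [|k] /= ->. Qed.

(* For [j] above the range of the definition all three terms vanish. *)
Lemma gibSS (R : realType) (alpha beta : R) (k : nat) (j : int) : 0 <= j ->
  gib alpha beta k.+2 j = gib alpha beta k.+1 j + gib alpha beta k (j - 1).
Proof.
move=> j0; have [jk|jk] := boolP ((j < 0) || ((k.+2./2)%:Z < j)).
  by rewrite !gib_eq0 ?addr0 //; lia.
by rewrite [LHS]/= (negbTE jk).
Qed.

Definition gib_poly {R : realType} (alpha beta : R) (k : nat) : {poly R} :=
  \poly_(j < (k./2).+1) gib alpha beta k j%:Z.

(** Beyond the degree bound both sides vanish, so coefficients can be compared without a side
    condition on [j]. *)
Lemma coef_gib_poly (R : realType) (alpha beta : R) (k j : nat) :
  (gib_poly alpha beta k)`_j = gib alpha beta k j%:Z.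
Proof.
rewrite coef_poly; case: ltnP => // kj.
by rewrite gib_eq0 //; lia.
Qed.

Lemma gib_polySS (R : realType) (alpha beta : R) (k : nat) :
  gib_poly alpha beta k.+2 =
  gib_poly alpha beta k.+1 + 'X * gib_poly alpha beta k.
Proof.
apply/polyP => j; rewrite coefD coefXM !coef_gib_poly gibSS //.
(* At [j = 0] the shifted index is -1, where [gib] vanishes, as does the constant coefficient of a
   multiple of ['X]. *)
case: j => [|j]; first by rewrite (@gib_eq0 _ _ _ k).
by congr (_ + gib _ _ _ _); lia.
Qed.

Lemma gib_poly0 (R : realType) (alpha beta : R) :
  gib_poly alpha beta 0 = alpha%:P.
Proof.
by apply/polyP => -[|j]; rewrite coef_gib_poly coefC.
Qed.

Lemma gib_poly1 (R : realType) (alpha beta : R) :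
  gib_poly alpha beta 1 = beta%:P.
Proof.
by apply/polyP => -[|j]; rewrite coef_gib_poly coefC.
Qed.

Lemma gib_polyW (R : realType) (q : R) (k : nat) : gib_poly q 1 k.+1 = W q k.
Proof.
elim/ltn_ind: k => -[|[|k]] IH; first exact: gib_poly1.
  (* The initial value [q] of index 0 enters only here, as the linear term of [W q 1]. *)
  by rewrite gib_polySS gib_poly0 gib_poly1 /= mulrC mul_polyC.
by rewrite gib_polySS !IH.
Qed.

Lemma horner_Gbar (R : realType) (alpha beta : R) (k : nat) (x : R) : x != 0 ->
  (Gbar alpha beta k).[x] = x ^+ k./2 * (gib_poly alpha beta k).[- x^-1].
Proof.
move=> x0; rewrite /Gbar big_mkord horner_sum horner_poly mulr_sumr.
apply: eq_bigr => j _; rewrite hornerZ hornerXn.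
(* This bound keeps the natural subtraction in the exponent exact, so that (-1)^j x^(k/2 - j) =
   x^(k/2) (-1/x)^j. *)
have jk : (j <= k./2)%N by rewrite -ltnS.
by rewrite expfB_cond ?(negbTE x0) // (exprNn x^-1) exprVn; ring.
Qed.

Theorem proposition2p2 (R : realType) (q : R) (hq : 0 < q) (k : nat)
    (hk : (2 <= k)%N) (x : R) (hx : x <> 0) :
  (Gbar q 1 k).[x] = x ^+ (k./2) * (W q (k - 1)).[- (1 / x)].
Proof.
rewrite horner_Gbar; last exact/eqP.
by case: k hk => // k _; rewrite gib_polyW subSS subn0 div1r.
Qed.
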